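(* Let $\phi:\mathbb{R}_+\to\mathbb{R}$ be lower semicontinuous and convex with $\phi(1)=0$, let $\delta\in[0,1]$, and for $\alpha\in\mathbb{R}$ let $$\mathcal{A}_\alpha=\Big\{\mu\in\Delta^n:\ \frac1n\sum_{i=1}^n\phi(n\mu_i)\le\alpha\Big\}.$$ Let $\alpha_\star$ denote the smallest (infimal) $\alpha$ such that for all $\theta\in\Theta$ $$\mathbb{P}\left[\sup_{\mu\in\mathcal{A}_\alpha}\ \sum_{i=1}^n\mu_i\,\ell_i(\theta)\ \ge\ \mathbb{E}[\ell(\theta,\xi)]\right]\ge 1-\delta .$$ Then $$\alpha_\star\ \le\ \inf\left\{\alpha\in\mathbb{R}:\ \mathbb{P}\left[I_\phi^\diamond(\nu)\le\alpha\right]\ge 1-\delta\right\},$$ where $\nu$ is uniformly distributed over $\Delta^n$ and, with $\phi^*(s)=\sup_{t\ge0}\{ts-\phi(t)\}$, $$I_\phi^\diamond(\nu)=\sup_{\lambda\in\mathbb{R}^n_\uparrow}\ \left\{\sum_{i=1}^n\Big(\nu_i\lambda_i-\frac1n\phi^*(\lambda_i)\Big)\right\}.$$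
   Context: Notation: $\Delta^n=\{\mu\in\mathbb{R}^n:\sum_{i=1}^n\mu_i=1,\ \mu_i\ge 0\}$ is the probability simplex, and $\mathbb{R}^n_\uparrow=\{x\in\mathbb{R}^n:x_1\le x_2\le\dots\le x_n\}$ is the monotone cone. The uniform distribution over $\Delta^n$ is the Dirichlet distribution with parameters $(1,\dots,1)$. Setting (expected risk minimization): $\Theta\subseteq\mathbb{R}^{n_\theta}$, $\xi$ is a random vector with values in $\Xi\subseteq\mathbb{R}^{n_\xi}$, $\ell(\theta,\xi)$ is a real-valued loss, and $\xi^{(1)},\dots,\xi^{(n-1)}$ are independent samples identically distributed as $\xi$ ($n\ge2$). Write $\ell_i(\theta)=\ell(\theta,\xi^{(i)})$ for $i=1,\dots,n-1$, and let $\ell_n(\theta)$ be a finite deterministic number with $\mathbb{P}[\ell(\theta,\xi)\le\ell_n(\theta)]=1$ for every $\theta\in\Theta$. By convention the supremum over an empty set is $-\infty$ and the infimum over an empty set is $+\infty$. *)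

(* Defs.v *)
(* MathComp-Analysis; R^k is represented by k.-tuple R throughout, which the
   library equips with the product sigma-algebra. *)
From HB Require Import structures.
From mathcomp Require Export all_boot all_order all_algebra.
From mathcomp Require Export all_classical all_reals all_analysis.
Export Order.TTheory GRing.Theory Num.Theory.
Export numFieldNormedType.Exports.

Set Implicit Arguments.
Unset Strict Implicit.
Unset Printing Implicit Defensive.
#[export] Set Implicit Arguments.
#[export] Unset Strict Implicit.
#[export] Unset Printing Implicit Defensive.

Local Open Scope classical_set_scope.
Local Open Scope ring_scope.

Section deterministic.
Context {R : realType}.

Definition simplex (n : nat) : set (n.-tuple R) :=
  [set mu | \sum_(i < n) tnth mu i = 1 /\ forall i : 'I_n, 0 <= tnth mu i].

Definition monotone_cone (n : nat) : set (n.-tuple R) :=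
  [set x | sorted <=%R x].

(* A function R_+ -> R is encoded as phi : R -> R whose values on negative
   reals are irrelevant: the predicates and constructions below only look at
   phi on [0, +oo[. *)

(* Lower semicontinuity for the topology of the subspace [0, +oo[. *)
Definition lsc_Rplus (phi : R -> R) : Prop :=
  lower_semicontinuous
    (fun x : subspace (`[0, +oo[ : set R) => (phi x)%:E).

Definition convex_Rplus (phi : R -> R) : Prop :=
  @convex_function R R^o `[0, +oo[ phi.

Definition conjugate (phi : R -> R) (s : R) : \bar R :=
  ereal_sup [set (t * s - phi t)%:E | t in `[0, +oo[].

(* The summands are never of the form oo - oo, as conjugate phi s >= s - phi 1
   is never -oo. *)
Definition I_diamond (phi : R -> R) (n : nat) (nu : n.-tuple R) : \bar R :=
  ereal_sup [set (\sum_(i < n) ((tnth nu i * tnth lam i)%:E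
                                - n%:R^-1%:E * conjugate phi (tnth lam i)))%E
            | lam in @monotone_cone n].

Definition ambiguity_set (phi : R -> R) (alpha : R) (n : nat) :
    set (n.-tuple R) :=
  [set mu | simplex mu /\
            n%:R^-1 * \sum_(i < n) phi (n%:R * tnth mu i) <= alpha].

(* The supremum is taken in the extended reals: it is -oo if the ambiguity set
   is empty. *)
Definition worst_case (phi : R -> R) (alpha : R) (n : nat) (l : 'I_n -> R) :
    \bar R :=
  ereal_sup [set (\sum_(i < n) tnth mu i * l i)%:E
            | mu in @ambiguity_set phi alpha n].

(* The n losses: those of the n - 1 samples, followed by the bound b. *)
Definition losses (n : nat) (T : Type) (l : T -> R) (b : R)
    (xs : 'I_n.-1 -> T) (i : 'I_n) : R :=
  if insub (val i) is Some j then l (xs j) else b.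

(* k-dimensional Lebesgue measure, as an iterated integral. *)
Fixpoint volume (k : nat) : set (k.-tuple R) -> \bar R :=
  match k with
  | 0 => fun A => (\1_A ([tuple] : 0.-tuple R))%:E
  | k'.+1 => fun A =>
      (\int[@lebesgue_measure R]_x
         volume [set t : k'.-tuple R | A [tuple of x :: t]])%E
  end.

Definition drop_last (n : nat) (x : n.-tuple R) : n.-1.-tuple R :=
  [tuple tnth x (widen_ord (leq_pred n) i) | i < n.-1].

End deterministic.

Section probabilistic.
Context {d : measure_display} {T : measurableType d} {R : realType}.

(* The Dirichlet distribution with parameters (1, ..., 1): in the coordinates
   x_1, ..., x_(n-1) it has the constant density
   Gamma(n) / (Gamma(1) ... Gamma(1)) = (n - 1)! on the image of the simplex
   (the last coordinate being 1 - x_1 - ... - x_(n-1)). *)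
Definition uniform_on_simplex (n : nat) (P : probability T R)
    (nu : {RV P >-> n.-tuple R}) : Prop :=
  forall B : set (n.-tuple R), measurable B ->
    distribution P nu B =
      ((n.-1)`!%:R%:E * volume (@drop_last R n @` (@simplex R n `&` B)))%E.

Definition mutually_independent (d' : measure_display)
    (T' : measurableType d') (I : finType) (P : probability T R)
    (X : I -> {RV P >-> T'}) : Prop :=
  forall (J : {set I}) (A : I -> set T'), (forall i, measurable (A i)) ->
    P (\bigcap_(i in [set` J]) (X i @^-1` A i)) =
      (\prod_(i in J) P (X i @^-1` A i))%E.

Definition identically_distributed (d' : measure_display)
    (T' : measurableType d') (P : probability T R)
    (X Y : {RV P >-> T'}) : Prop :=
  forall A : set T', measurable A -> distribution P X A = distribution P Y A.

(* Measurability of f restricted to D for the trace sigma-algebra on D.  For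
   measurable D this is measurable_fun D f, but the latter is void when D is
   not measurable. *)
Definition trace_measurable (D : set T) (f : T -> R) : Prop :=
  forall B : set R, measurable B ->
    exists2 C : set T, measurable C & D `&` f @^-1` B = D `&` C.

End probabilistic.

(* Main.v *)
From HB Require Import structures.
From mathcomp Require Import perm.
Require Import Defs.
From mathcomp Require Import measurable_realfun ring lra.

Local Open Scope classical_set_scope.
Local Open Scope ring_scope.

(** Fix theta and let X be the loss, b its almost sure upper bound, q its
    quantile function, and k = n - 1 the number of samples.

    The sampled losses have the law of (q u_1, ..., q u_k), where the u_i are
    independent and uniform on [0, 1] ([sample_law]).  Suppose first that
    0 = u_0 < u_1 < ... < u_k <= 1, and let l = (q u_1, ..., q u_k, b) and
    nu = (u_1 - u_0, ..., u_k - u_(k-1), 1 - u_k).  Since P(X <= q u) >= u, the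
    mean of X is at most that of the step function with value q u_i on
    ]u_(i-1), u_i] and b on ]u_k, 1], that is, E X <= sum_i nu_i l_i
    ([expectation_le]).

    On the other hand, I_diamond nu is the value of a Lagrangian dual: if it is
    at most alpha, and alpha > 0, then sum_i nu_i l_i is at most the supremum of
    sum_i mu_i l_i over the ambiguity set of radius alpha, for every sorted l
    ([worst_case_ge]).  Otherwise a multiplier gamma of the divergence
    constraint and a multiplier eta of the constraint sum_i mu_i = 1 would
    produce the point (l - eta) / gamma of the monotone cone, at which the
    expression defining I_diamond nu exceeds alpha.  Two multiplier rules in the
    plane are all that is needed, so no separation theorem in dimension n is
    involved.

    Thus the event of the theorem contains {I_diamond nu <= alpha} when the u_i
    are sorted.  The event is symmetric in the samples ([worst_case_perm]), so
    its probability is at least k! times the volume of the sorted u with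
    I_diamond nu <= alpha ([power_symmetrize]), and taking spacings preserves the
    volume ([volume_spacings]): this bound is the probability that
    I_diamond <= alpha under the uniform distribution on the simplex
    ([uniform_le], [coverage]).  As I_diamond is nonnegative on the simplex
    ([I_diamond_ge0]), an admissible alpha on the right-hand side is nonnegative
    unless delta = 1; hence every alpha' > alpha is positive and admissible on
    the left-hand side.

    The two events are defined by suprema over uncountable sets.  They are
    measurable because, up to complement, they are open ([coordwise_open]). *)

(** * Multiplier rules in the plane *)

Lemma lt_EFin_between (R : realType) (x : \bar R) (e : R) :
  (x < e%:E)%E -> exists2 m : R, (x <= m%:E)%E & m < e.
Proof.
case: x => [r||] //; first by rewrite lte_fin => re; exists r.
by move=> _; exists (e - 1); rewrite ?leNye// gtrBl.
Qed.

Section multipliers.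
Context {R : realType} {X : Type} (K : set X) (g f : X -> R) (v : R).

(** The points (g x, f x) with g x < 0 and those with g x > 0 are separated by a
    line through (0, v): its slope is the supremum of the slopes from (0, v) to
    the points on the right, and the last hypothesis says that each of these
    slopes is at most each slope on the left. *)
Lemma separating_slope :
  (exists2 x, K x & g x < 0) -> (exists2 y, K y & 0 < g y) ->
  (forall x y, K x -> K y -> g x < 0 -> 0 < g y ->
     g y * f x - g x * f y <= v * (g y - g x)) ->
  exists eta, forall x, K x -> g x != 0 -> f x - eta * g x <= v.
Proof.
move=> [x0 Kx0 gx0] [y0 Ky0 gy0] cross.
pose slope y := (f y - v) / g y.
pose S := [set slope y | y in [set y | K y /\ 0 < g y]].
have S_ub x : K x -> g x < 0 -> ubound S (slope x).
  move=> Kx gx _ [y [Ky gy] <-]; rewrite /slope.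
  rewrite -[leRHS](_ : (v - f x) / - g x = _); last first.
    by rewrite invrN mulrN -mulNr opprB.
  rewrite ler_pdivrMr// mulrAC ler_pdivlMr ?oppr_gt0//.
  have := cross _ _ Kx Ky gx gy; lra.
have S0 : S !=set0 by exists (slope y0), y0.
exists (sup S) => x Kx; rewrite neq_lt => /orP[gx|gx].
- have : sup S <= slope x by apply: ge_sup S0 (S_ub _ Kx gx).
  by rewrite /slope ler_ndivlMr//; lra.
- have : slope x <= sup S.
    apply: ub_le_sup; last by exists x.
    by exists (slope x0); exact: S_ub.
  by rewrite /slope ler_pdivrMr//; lra.
Qed.

(** The weight at which the segment from a to b meets 0. *)
Lemma convex_weight a b : a < 0 :> R -> 0 < b ->
  0 <= b / (b - a) <= 1.
Proof.
move=> a0 b0; have ba : 0 < b - a by lra.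
apply/andP; split; first by rewrite divr_ge0// ltW.
by rewrite ler_pdivrMr//; lra.
Qed.

(** Lagrange multiplier for maximizing a concave f under an affine constraint
    g = 0.  Concavity is stated as the existence of the points z, which makes the
    rule usable on a set K without algebraic structure. *)
Lemma equality_multiplier :
  (forall x y (t : R), K x -> K y -> 0 <= t <= 1 ->
     exists z, [/\ K z, g z = t * g x + (1 - t) * g y &
                   t * f x + (1 - t) * f y <= f z]) ->
  (exists2 x, K x & g x < 0) -> (exists2 y, K y & 0 < g y) ->
  (forall x, K x -> g x = 0 -> f x <= v) ->
  exists eta, forall x, K x -> f x - eta * g x <= v.
Proof.
move=> mix gneg gpos fv.
have [|eta etaP] := separating_slope gneg gpos.
  move=> x y Kx Ky gx gy; have ba : 0 < g y - g x by lra.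
  have [z [Kz gz fz]] := mix _ _ _ Kx Ky (convex_weight gx gy).
  have /(le_trans fz) : f z <= v by apply: fv => //; rewrite gz; field; lra.
  rewrite -(ler_pM2r ba); congr (_ <= _); field; lra.
exists eta => x Kx; have [gx|] := eqVneq (g x) 0; last exact: etaP.
by rewrite gx mulr0 subr0; exact: fv.
Qed.

(** Under a convex constraint g <= 0 the multiplier is nonnegative.  A negative
    slope can be replaced by 0, as can any slope when the constraint holds on the
    whole of K. *)
Lemma inequality_multiplier :
  (forall x y (t : R), K x -> K y -> 0 <= t <= 1 ->
     exists z, [/\ K z, g z <= t * g x + (1 - t) * g y &
                   t * f x + (1 - t) * f y <= f z]) ->
  (exists2 x, K x & g x < 0) ->
  (forall x, K x -> g x <= 0 -> f x <= v) ->
  exists2 gamma, 0 <= gamma & forall x, K x -> f x - gamma * g x <= v.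
Proof.
move=> mix gneg fv.
have [gpos|gpos] := pselect (exists2 y, K y & 0 < g y); last first.
  exists 0 => // x Kx; rewrite mul0r subr0; apply: fv => //.
  by rewrite leNgt; apply/negP => gx; apply: gpos; exists x.
have [|gamma gammaP] := separating_slope gneg gpos.
  move=> x y Kx Ky gx gy; have ba : 0 < g y - g x by lra.
  have [z [Kz gz fz]] := mix _ _ _ Kx Ky (convex_weight gx gy).
  have /(le_trans fz) : f z <= v.
    apply: fv => //; apply: (le_trans gz).
    by rewrite le_eqVlt; apply/orP; left; apply/eqP; field; lra.
  rewrite -(ler_pM2r ba); congr (_ <= _); field; lra.
have [gamma0|gamma0] := leP 0 gamma.
  exists gamma => // x Kx; have [gx|] := eqVneq (g x) 0; last exact: gammaP.
  by rewrite gx mulr0 subr0; apply: fv; rewrite ?gx.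
exists 0 => // x Kx; rewrite mul0r subr0.
have [gx|gx] := leP (g x) 0; first exact: fv.
have := gammaP _ Kx (lt0r_neq0 gx).
have : gamma * g x <= 0 by rewrite nmulr_rle0// ltW.
lra.
Qed.

End multipliers.

(** * Duality for the divergence ball *)

Section duality.
Context {R : realType} (phi : R -> R).
Hypothesis phi_convex : convex_Rplus phi.
Hypothesis phi1 : phi 1 = 0.
Implicit Types (n : nat).

Lemma convex_RplusP (x y t : R) : 0 <= x -> 0 <= y -> 0 <= t <= 1 ->
  phi (t * x + (1 - t) * y) <= t * phi x + (1 - t) * phi y.
Proof.
move=> x0 y0 t01.
have := @phi_convex (Itv01 (andP t01).1 (andP t01).2) x y.
rewrite !inE/= !in_itv/= !andbT => /(_ x0 y0).
by rewrite !convRE.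
Qed.

(** The subgradient is the multiplier of the constraint t = 1 in the minimization
    of phi. *)
Lemma subgradient_at1 : exists c : R, forall t, 0 <= t -> c * (t - 1) <= phi t.
Proof.
have [x y t /= x0 y0 t01||||eta etaP] :=
    @equality_multiplier R R [set t | 0 <= t] (fun t => t - 1)
      (fun t => - phi t) 0.
- exists (t * x + (1 - t) * y); split.
  + have := mulr_ge0 (andP t01).1 x0; case/andP: t01 => ? ?.
    have : 0 <= (1 - t) * y by rewrite mulr_ge0//; lra.
    lra.
  + by ring.
  + by have := convex_RplusP x0 y0 t01; lra.
- by exists 0 => //=; lra.
- by exists 2 => //=; lra.
- by move=> t /= _ /eqP; rewrite subr_eq0 => /eqP ->; rewrite phi1 oppr0.
by exists (- eta) => t t0; have := etaP _ t0; lra.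
Qed.

Lemma conjugate_ge (s t : R) : 0 <= t ->
  ((t * s - phi t)%:E <= conjugate phi s)%E.
Proof.
by move=> t0; apply: ereal_sup_ubound; exists t; rewrite //= in_itv/= t0.
Qed.

Lemma conjugate_gtNy (s : R) : (-oo < conjugate phi s)%E.
Proof. by apply: lt_le_trans (conjugate_ge s ler01); rewrite ltNyr. Qed.

Lemma monotone_coneP n (x : n.-tuple R) :
  monotone_cone x <-> {homo tnth x : i j / (i <= j)%N >-> i <= j}.
Proof.
split=> [x_sorted i j ij|x_homo].
  rewrite !(tnth_nth 0); apply: sorted_leq_nth => //; try exact: le_trans.
  - by rewrite inE size_tuple.
  - by rewrite inE size_tuple.
apply/(sortedP 0) => i; rewrite size_tuple => i_lt.
have i_lt' := ltnW i_lt.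
have := x_homo (Ordinal i_lt') (Ordinal i_lt) (leqnSn i).
by rewrite !(tnth_nth 0).
Qed.

(** The objective of the supremum defining [I_diamond]. *)
Definition dual_value n (nu lam : n.-tuple R) : \bar R :=
  (\sum_(i < n) ((tnth nu i * tnth lam i)%:E
                 - n%:R^-1%:E * conjugate phi (tnth lam i)))%E.

Lemma dual_value_le n (nu lam : n.-tuple R) : monotone_cone lam ->
  (dual_value nu lam <= I_diamond phi nu)%E.
Proof. by move=> lamS; apply: ereal_sup_ubound; exists lam. Qed.

Definition pairing n (x y : n.-tuple R) := \sum_(i < n) tnth x i * tnth y i.

Lemma dual_valueE n (nu lam : n.-tuple R) :
  (forall i, conjugate phi (tnth lam i) \is a fin_num) ->
  dual_value nu lam = (pairing nu lam -
    n%:R^-1 * \sum_(i < n) fine (conjugate phi (tnth lam i)))%:E.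
Proof.
move=> lam_fin; rewrite mulr_sumr -sumrB -sumEFin; apply: eq_bigr => i _.
by rewrite EFinB (EFinM n%:R^-1) fineK.
Qed.

(** At the constant point c, where c is a subgradient of phi at 1, the conjugate
    is at most c and the dual value is nonnegative. *)
Lemma I_diamond_ge0 n (nu : n.-tuple R) : (0 < n)%N -> simplex nu ->
  (0 <= I_diamond phi nu)%E.
Proof.
move=> n0 [nu1 _]; have [c cP] := subgradient_at1.
have conj_c : (conjugate phi c <= c%:E)%E.
  apply: ge_ereal_sup => _ [t /=] + <-; rewrite in_itv/= andbT => t0.
  by rewrite lee_fin; have := cP _ t0; lra.
pose lam : n.-tuple R := [tuple c | _ < n].
have lamS : monotone_cone lam.
  by apply/monotone_coneP => i j _; rewrite !tnth_mktuple.
apply: le_trans (dual_value_le nu lamS).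
apply: (@le_trans _ _
    (\sum_(i < n) ((tnth nu i * c)%:E - n%:R^-1%:E * c%:E))%E).
  rewrite sumEFin lee_fin sumrB -mulr_suml nu1 sumr_const card_ord.
  by rewrite -mulrnAl -mulr_natr mulVf ?pnatr_eq0 -?lt0n// subrr.
by apply: lee_sum => i _; rewrite tnth_mktuple leeB// lee_wpmul2l.
Qed.

(** A supremum of sums of functions of separate variables is the sum of the
    suprema. *)
Lemma sum_conjugate_le n (lam : 'I_n -> R) (k : R) :
  (forall t : 'I_n -> R, (forall i, 0 <= t i) ->
     \sum_(i < n) (t i * lam i - phi (t i)) <= k) ->
  (forall i, conjugate phi (lam i) \is a fin_num) /\
  \sum_(i < n) fine (conjugate phi (lam i)) <= k.
Proof.
move=> tk.
have conj_fin i : conjugate phi (lam i) \is a fin_num.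
  rewrite fin_real// conjugate_gtNy/=.
  pose rest := \sum_(j < n | j != i) (1 * lam j - phi 1).
  apply: (@le_lt_trans _ _ (k - rest)%:E); last exact: ltry.
  apply: ge_ereal_sup => _ [t /=] + <-; rewrite in_itv/= andbT => t0.
  rewrite lee_fin lerBrDr.
  have := tk (fun j => if j == i then t else 1).
  rewrite (bigD1 i)//= eqxx (eq_bigr (fun j => 1 * lam j - phi 1)).
    by apply=> j; case: ifP.
  by move=> j /negbTE ->.
split => //; apply/ler_addgt0Pr => e e0.
have n0 : 0 < n.+1%:R :> R by rewrite ltr0n.
have near_sup i : {t : R | 0 <= t &
    fine (conjugate phi (lam i)) - e / n.+1%:R <= t * lam i - phi t}.
  apply/cid2.
  have [] := ub_ereal_sup_adherent (divr_gt0 e0 n0) (conj_fin i).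
  move=> _ [t /=] + <-; rewrite in_itv/= andbT => t0 /ltW h.
  exists t => //; move: h.
  by rewrite -/(conjugate _ _) -(fineK (conj_fin i)) -EFinB lee_fin.
have := tk (fun i => s2val (near_sup i)) (fun i => s2valP (near_sup i)).
rewrite -(lerD2r e); apply: le_trans; rewrite -lerBlDr.
apply: (@le_trans _ _
    (\sum_(i < n) (fine (conjugate phi (lam i)) - e / n.+1%:R))).
  rewrite sumrB lerD2l lerN2 sumr_const card_ord -[leLHS]mulr_natr mulrAC.
  by rewrite ler_pdivrMr// ler_pM2l// ler_nat.
by apply: ler_sum => i _; exact: s2valP' (near_sup i).
Qed.

Definition mix n (t : R) (x y : n.-tuple R) : n.-tuple R :=
  [tuple t * tnth x i + (1 - t) * tnth y i | i < n].

Lemma sum_mix n (t : R) (x y : n.-tuple R) (c : 'I_n -> R) :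
  \sum_(i < n) tnth (mix t x y) i * c i =
  t * (\sum_(i < n) tnth x i * c i) + (1 - t) * (\sum_(i < n) tnth y i * c i).
Proof.
rewrite !mulr_sumr -big_split/=; apply: eq_bigr => i _.
by rewrite tnth_mktuple; ring.
Qed.

Lemma sum_mix1 n (t : R) (x y : n.-tuple R) :
  \sum_(i < n) tnth (mix t x y) i =
  t * (\sum_(i < n) tnth x i) + (1 - t) * (\sum_(i < n) tnth y i).
Proof.
rewrite !mulr_sumr -big_split/=; apply: eq_bigr => i _.
by rewrite tnth_mktuple.
Qed.

Lemma mix_ge0 n (t : R) (x y : n.-tuple R) : 0 <= t <= 1 ->
  (forall i, 0 <= tnth x i) -> (forall i, 0 <= tnth y i) ->
  forall i, 0 <= tnth (mix t x y) i.
Proof.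
move=> /andP[t0 t1] x0 y0 i.
by rewrite tnth_mktuple addr_ge0// mulr_ge0// subr_ge0.
Qed.

Definition divergence n (mu : n.-tuple R) : R :=
  n%:R^-1 * \sum_(i < n) phi (n%:R * tnth mu i).

Lemma divergence_mix n (t : R) (x y : n.-tuple R) : 0 <= t <= 1 ->
  (forall i, 0 <= tnth x i) -> (forall i, 0 <= tnth y i) ->
  divergence (mix t x y) <= t * divergence x + (1 - t) * divergence y.
Proof.
move=> t01 x0 y0; rewrite /divergence mulrCA [(1 - t) * _]mulrCA -mulrDr.
rewrite ler_wpM2l ?invr_ge0// !mulr_sumr -big_split/=.
apply: ler_sum => i _.
rewrite tnth_mktuple mulrDr mulrCA [_ * ((1 - t) * _)]mulrCA.
by apply: convex_RplusP => //; rewrite mulr_ge0.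
Qed.

(** The inequality multiplier gamma belongs to the constraint that the divergence
    is at most alpha, which the uniform mu = (1/n, ..., 1/n) satisfies strictly
    since alpha > 0; gamma = 0 would contradict v < pairing nu l at the point nu
    of the simplex.  The equality multiplier eta then removes the constraint
    sum_i mu_i = 1, after which the Lagrangian separates into the conjugates of
    phi at the points (l_i - eta) / gamma. *)
Lemma I_diamond_gt n (nu l : n.-tuple R) (alpha v : R) : (0 < n)%N ->
  simplex nu -> monotone_cone l -> 0 < alpha ->
  v < pairing nu l ->
  (forall mu, ambiguity_set phi alpha mu -> pairing mu l <= v) ->
  (alpha%:E < I_diamond phi nu)%E.
Proof.
move=> n0 nuS lS alpha0 v_lt v_ub.
have nR0 : n%:R != 0 :> R by rewrite pnatr_eq0 -lt0n.
have [|||gamma gamma0 gammaP] := @inequality_multiplier R _ (@simplex R n)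
    (fun mu => divergence mu - alpha) (fun mu => pairing mu l) v.
- move=> x y t [x1 x0] [y1 y0] t01; exists (mix t x y); split.
  + split; last exact: mix_ge0.
    by rewrite sum_mix1 x1 y1; ring.
  + by have := divergence_mix t01 x0 y0; lra.
  + by rewrite /pairing sum_mix.
- exists [tuple n%:R^-1 | _ < n].
    split=> [|i]; last by rewrite tnth_mktuple invr_ge0.
    under eq_bigr do rewrite tnth_mktuple.
    by rewrite sumr_const card_ord -[LHS]mulr_natr mulVf.
  rewrite /divergence; under eq_bigr do rewrite tnth_mktuple mulfV// phi1.
  by rewrite big1// mulr0 sub0r oppr_lt0.
- move=> mu muS; rewrite subr_le0 => mu_alpha; exact: v_ub.
have {gamma0}gamma_gt0 : 0 < gamma.
  rewrite lt_neqAle gamma0 andbT; apply/eqP => gammaE.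
  by have := gammaP _ nuS; rewrite -gammaE mul0r subr0 leNgt v_lt.
have [||||eta etaP] := @equality_multiplier R _
    [set mu : n.-tuple R | forall i, 0 <= tnth mu i]
    (fun mu => \sum_(i < n) tnth mu i - 1)
    (fun mu => pairing mu l - gamma * (divergence mu - alpha)) v.
- move=> x y t x0 y0 t01; exists (mix t x y); split.
  + exact: mix_ge0.
  + by rewrite sum_mix1; ring.
  + rewrite /pairing sum_mix.
    have := divergence_mix t01 x0 y0.
    by rewrite -(ler_pM2l gamma_gt0); lra.
- exists [tuple 0 | _ < n] => [i|]; first by rewrite tnth_mktuple.
  by rewrite big1 ?sub0r ?oppr_lt0// => i _; rewrite tnth_mktuple.
- exists [tuple 2 | _ < n] => [i|]; first by rewrite tnth_mktuple.
  under eq_bigr do rewrite tnth_mktuple.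
  rewrite sumr_const card_ord subr_gt0 -[ltRHS]mulr_natr -natrM ltr1n.
  by case: (n) n0 => // -[|m].
- by move=> mu mu0 /subr0_eq mu1; exact: gammaP.
pose lam := [tuple (tnth l i - eta) / gamma | i < n].
have [|lam_fin lam_le] := @sum_conjugate_le n (tnth lam)
    (n%:R * ((v - eta - gamma * alpha) / gamma)).
  move=> t t0.
  pose mu : n.-tuple R := [tuple t i / n%:R | i < n].
  have mu0 i : 0 <= tnth mu i by rewrite tnth_mktuple divr_ge0.
  have divE : divergence mu = n%:R^-1 * \sum_(i < n) phi (t i).
    congr (_ * _); apply: eq_bigr => i _.
    by rewrite tnth_mktuple mulrC divfK.
  have pairE : pairing mu l = n%:R^-1 * \sum_(i < n) t i * tnth l i.
    by rewrite mulr_sumr; apply: eq_bigr => i _; rewrite tnth_mktuple; ring.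
  have sumE : \sum_(i < n) tnth mu i = n%:R^-1 * \sum_(i < n) t i.
    by rewrite mulr_sumr; apply: eq_bigr => i _; rewrite tnth_mktuple mulrC.
  have -> : \sum_(i < n) (t i * tnth lam i - phi (t i)) =
      (\sum_(i < n) t i * tnth l i - eta * \sum_(i < n) t i) / gamma
      - \sum_(i < n) phi (t i).
    rewrite sumrB; congr (_ - _); rewrite mulr_sumr -sumrB mulr_suml.
    by apply: eq_bigr => i _; rewrite tnth_mktuple; ring.
  have := etaP _ mu0; rewrite divE pairE sumE.
  set a := \sum_(i < n) _; set b := \sum_(i < n) _; set c := \sum_(i < n) _.
  have gn0 : 0 < gamma / n%:R by rewrite divr_gt0// ltr0n.
  have gamma_neq0 : gamma != 0 by rewrite gt_eqF.
  move=> lagrangian_le; rewrite -(ler_pM2l gn0).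
  rewrite [leRHS](_ : _ = v - eta - gamma * alpha); last first.
    by field; rewrite nR0 gamma_neq0.
  rewrite [leLHS](_ : _ = n%:R^-1 * a - gamma * (n%:R^-1 * b)
                          - eta * (n%:R^-1 * c)); first lra.
  by field; rewrite nR0 gamma_neq0.
have lamS : monotone_cone lam.
  apply/monotone_coneP => i j ij; rewrite !tnth_mktuple.
  by rewrite ler_pM2r ?invr_gt0// lerB// (monotone_coneP _).1.
apply: lt_le_trans (dual_value_le nu lamS).
rewrite dual_valueE// lte_fin ltrBrDl.
apply: (@le_lt_trans _ _ ((v - eta - gamma * alpha) / gamma + alpha)).
  by rewrite lerD2r mulrC ler_pdivrMr ?ltr0n// mulrC.
rewrite -(ltr_pM2r gamma_gt0).
have -> : pairing nu lam = (pairing nu l - eta) / gamma.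
  (* the entries of nu sum to 1 *)
  rewrite -[eta]mulr1 -nuS.1 mulr_sumr -sumrB mulr_suml.
  by apply: eq_bigr => i _; rewrite tnth_mktuple; ring.
rewrite mulrDl !divfK ?gt_eqF//; lra.
Qed.

Lemma worst_case_ge n (nu l : n.-tuple R) (alpha : R) : (0 < n)%N ->
  simplex nu -> monotone_cone l -> 0 < alpha ->
  (I_diamond phi nu <= alpha%:E)%E ->
  ((pairing nu l)%:E <= worst_case phi alpha (tnth l))%E.
Proof.
move=> n0 nuS lS alpha0; apply: contraTT; rewrite -!ltNge.
move=> /lt_EFin_between[v wc_v v_lt].
apply: (I_diamond_gt n0 nuS lS alpha0 v_lt) => mu muA.
by rewrite -lee_fin; apply: le_trans wc_v; apply: ereal_sup_ubound; exists mu.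
Qed.

Lemma worst_case_perm alpha n (l : 'I_n -> R) (s : 'S_n) :
  worst_case phi alpha (l \o s) = worst_case phi alpha l.
Proof.
suff le (k : 'I_n -> R) (p : 'S_n) :
    (worst_case phi alpha (k \o p) <= worst_case phi alpha k)%E.
  apply/eqP; rewrite eq_le le/=; have := le (l \o s) s^-1%g.
  by congr (worst_case _ _ _ <= _)%E; apply/funext => i /=; rewrite permKV.
apply: ge_ereal_sup => _ [mu [[mu1 mu0] mu_alpha] <-].
have pE (F : 'I_n -> R) : \sum_(i < n) F (p^-1%g i) = \sum_(i < n) F i.
  by rewrite [RHS](reindex_inj (@perm_inj _ p^-1%g)).
apply: ereal_sup_ubound; exists [tuple tnth mu (p^-1%g i) | i < n].
  split; first split.
  - by under eq_bigr do rewrite tnth_mktuple; rewrite (pE (tnth mu)).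
  - by move=> i; rewrite tnth_mktuple.
  - under eq_bigr do rewrite tnth_mktuple.
    by rewrite (pE (fun i => phi (n%:R * tnth mu i))).
congr EFin; rewrite -[RHS]pE; apply: eq_bigr => i _.
by rewrite tnth_mktuple/= permKV.
Qed.

End duality.

(** * Powers of a probability *)

Section product_probability.
Local Open Scope ereal_scope.
Context {d1 d2} {T1 : measurableType d1} {T2 : measurableType d2}.
Context {R : realType}.
Variables (P : probability T1 R) (Q : probability T2 R).

Let prodT : (P \x Q) setT = 1.
Proof.
rewrite -setXTT; transitivity (P setT * Q setT); first exact: product_measure1E.
by rewrite !probability_setT mule1.
Qed.

HB.instance Definition _ := Measure_isProbability.Build _ _ R (P \x Q) prodT.

End product_probability.

Section power.
Context {d} {T : measurableType d} {R : realType}.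

Definition cons_pair k (p : T * k.-tuple T) : k.+1.-tuple T :=
  [tuple of p.1 :: p.2].

Lemma measurable_cons_pair k : measurable_fun setT (@cons_pair k).
Proof. exact: measurable_cons. Qed.

HB.instance Definition _ k :=
  isMeasurableFun.Build _ _ _ _ (@cons_pair k) (@measurable_cons_pair k).

Variable mu : probability T R.

(** The joint law of k independent random variables of law mu. *)
Fixpoint power k : probability (k.-tuple T) R :=
  match k with
  | 0 => \d_([tuple] : 0.-tuple T)
  | k'.+1 => distribution (mu \x power k')%E (@cons_pair k')
  end.

Lemma powerS k (A : set (k.+1.-tuple T)) :
  power k.+1 A =
    (\int[mu]_x power k [set t : k.-tuple T | A [tuple of x :: t]])%E.
Proof.
rewrite /= /distribution /pushforward /product_measure1.
apply: eq_integral => x _ /=.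
by congr (power k _); apply/seteqP; split => t; rewrite /xsection/= inE.
Qed.

Lemma measurable_section k (A : set (k.+1.-tuple T)) x : measurable A ->
  measurable [set t : k.-tuple T | A [tuple of x :: t]].
Proof.
move=> mA; rewrite -[X in measurable X]setTI.
by apply: (measurable_cons (measurable_cst x) (@measurable_id _ _ setT)).
Qed.

Lemma measurable_fun_section k (A : set (k.+1.-tuple T)) : measurable A ->
  measurable_fun setT
    ((fun x => power k [set t : k.-tuple T | A [tuple of x :: t]])
      : T -> \bar R).
Proof.
move=> mA.
have mA' : measurable (@cons_pair k @^-1` A).
  by rewrite -[X in measurable X]setTI; exact: measurable_cons_pair.
apply: eq_measurable_fun (measurable_fun_xsection (power k) mA') => x _ /=.
by congr (power k _); apply/seteqP; split => t; rewrite /xsection/= inE.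
Qed.

Definition rectangle k (B : 'I_k -> set T) : set (k.-tuple T) :=
  [set x | forall i, B i (tnth x i)].

Lemma measurable_rectangle n (B : 'I_n -> set T) :
  (forall i, measurable (B i)) -> measurable (rectangle B).
Proof.
move=> mB.
rewrite (_ : rectangle B =
    \bigcap_(i in [set: 'I_n]) ((@tnth n T)^~ i @^-1` B i)).
  apply: fin_bigcap_measurable => // i _; rewrite -[X in measurable X]setTI.
  exact: measurable_tnth.
by apply/seteqP; split => [x xB i _|x xB i]; exact: xB.
Qed.

Lemma power_rectangle k (B : 'I_k -> set T) : (forall i, measurable (B i)) ->
  power k (rectangle B) = (\prod_(i < k) mu (B i))%E.
Proof.
elim: k B => [|k IH] B mB.
  by rewrite big_ord0 /= diracE mem_set// => -[].
rewrite powerS big_ord_recl -IH//.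
rewrite (eq_integral (fun x => (\1_(B ord0) x)%:E *
    power k (rectangle (fun i => B (lift ord0 i))))%E).
  rewrite ge0_integralZr//; last exact/measurable_EFinP.
  by rewrite integral_indic// setIT.
move=> x _; rewrite indicE; case: (boolP (x \in _)) => [|/negP] xB0.
  rewrite mul1e; congr (power k _); apply/seteqP; split => t tB i.
    by have := tB (lift ord0 i); rewrite tnthS.
  case: (unliftP ord0 i) => [j|] ->; first by rewrite tnthS; exact: tB.
  by rewrite tnth0; rewrite inE in xB0.
rewrite mul0e -[RHS](measure0 (power k)); congr (power k _).
apply/seteqP; split => t // /(_ ord0); rewrite tnth0 => B0x.
by apply: xB0; rewrite inE.
Qed.

End power.

(** Rectangles are closed under intersection and generate the product
    sigma-algebra. *)
Lemma tuple_probability_unique d (T : measurableType d) (R : realType) k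
    (P Q : {finite_measure set (k.-tuple T) -> \bar R}) :
  (forall B : 'I_k -> set T, (forall i, measurable (B i)) ->
     P (rectangle B) = Q (rectangle B)) ->
  forall A, measurable A -> P A = Q A.
Proof.
move=> PQ A mA.
pose G : set (set (k.-tuple T)) :=
  [set rectangle B | B in [set B : 'I_k -> set T | forall i, measurable (B i)]].
apply: (measure_unique G (fun=> setT)) => //.
- apply/seteqP; split.
    apply: smallest_sub; first exact: smallest_sigma_algebra.
    rewrite -bigcup_seq; apply: bigcup_sub => i _ _ [B mB <-].
    apply: sub_sigma_algebra.
    exists (fun j => if j == i then B else setT).
      by move=> j; case: ifP.
    apply/seteqP; split => [x xB|x [_ xB] j].
      by split => //; have := xB i; rewrite eqxx.
    by case: eqP => [->|].
  by apply: smallest_sub; [exact: sigma_algebra_measurable|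
    move=> _ [B mB <-]; exact: measurable_rectangle].
- move=> _ _ [B mB <-] [C mC <-]; exists (fun i => B i `&` C i).
    by move=> i; exact: measurableI.
  apply/seteqP; split => [x xBC|x [xB xC] i]; last by split.
  by split => i; have [] := xBC i.
- by move=> i; exists (fun=> setT) => //; apply/seteqP; split.
- by rewrite bigcup_const.
- by move=> _ [B mB <-]; exact: PQ.
- by move=> n; rewrite ltey_eq fin_num_measure.
Qed.

Section permutation.
Context {d} {T : measurableType d} {R : realType} (mu : probability T R).

Definition permute k (s : 'S_k) (x : k.-tuple T) : k.-tuple T :=
  [tuple tnth x (s i) | i < k].

Lemma measurable_permute k (s : 'S_k) : measurable_fun setT (permute s).
Proof.
apply/measurable_fun_tnthP => i.
rewrite (_ : _ \o _ = (@tnth k T)^~ (s i)); first exact: measurable_tnth.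
by apply/funext => x /=; rewrite tnth_mktuple.
Qed.

HB.instance Definition _ k (s : 'S_k) :=
  isMeasurableFun.Build _ _ _ _ (@permute k s) (measurable_permute s).

Lemma power_permute k (s : 'S_k) A : measurable A ->
  power mu k (permute s @^-1` A) = power mu k A.
Proof.
move=> mA.
rewrite -[LHS]/(distribution (power mu k) (permute s) A).
apply: tuple_probability_unique => // B mB.
transitivity (power mu k (rectangle (B \o s^-1%g))).
  congr (power mu k _); apply/seteqP; split => x xB i.
    by have := xB (s^-1%g i); rewrite tnth_mktuple permKV.
  by have := xB (s i); rewrite /= permK tnth_mktuple.
rewrite power_rectangle => [|i]; last exact: mB.
transitivity (\prod_(i < k) mu (B i))%E; last exact/esym/power_rectangle.
rewrite (reindex_inj (@perm_inj _ s)); apply: eq_bigr => i _.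
by rewrite /= permK.
Qed.

(** The hypotheses say that the k! sets permute s @^-1` V are disjoint and
    contained in S; they all have the same probability. *)
Lemma power_symmetrize k (V S : set (k.-tuple T)) :
  measurable V -> measurable S ->
  (forall x s, V (permute s x) -> S x) ->
  (forall x s1 s2, V (permute s1 x) -> V (permute s2 x) -> s1 = s2) ->
  (k`!%:R%:E * power mu k V <= power mu k S)%E.
Proof.
move=> mV mS VS V_inj.
have mVs (s : 'S_k) : measurable (permute s @^-1` V).
  by rewrite -[X in measurable X]setTI; exact: measurable_permute.
pose F (i : 'I_#|{perm 'I_k}|) := permute (enum_val i) @^-1` V.
have mF i : measurable (F i) by exact: mVs.
apply: (@le_trans _ _ (power mu k (\big[setU/set0]_i F i))); last first.
  apply: le_measure; rewrite ?inE//.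
    by apply: bigsetU_measurable => i _.
  apply: (big_ind (fun A => A `<=` S)) => // [A B AS BS x [/AS|/BS]|i _ x] //.
  exact: VS.
rewrite (@measure_bigsetU_ord _ _ _ _ _ predT)//; last first.
  apply/trivIsetP => i j _ _ /eqP ij; apply/seteqP; split => // x [Vi Vj].
  by case: ij; apply: enum_val_inj; exact: V_inj Vi Vj.
rewrite (eq_bigr (fun=> power mu k V)); last first.
  by move=> i _; exact: power_permute.
rewrite -(fineK (fin_num_measure (power mu k) _ mV)) sumEFin -EFinM lee_fin.
by rewrite sumr_const card_ord card_Sn mulr_natl.
Qed.

End permutation.

(** * Measurability of the two events *)

Section open.
Context {R : realType}.

(** Openness in the product topology, spelled out on tuples. *)
Definition coordwise_open n (U : set (n.-tuple R)) :=
  forall x, U x -> exists2 e : R, 0 < e &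
    forall y, (forall i, `|tnth y i - tnth x i| < e) -> U y.

(** An open set is the union of the countably many rational boxes that it
    contains. *)
Lemma coordwise_open_measurable n (U : set (n.-tuple R)) :
  coordwise_open U -> measurable U.
Proof.
move=> oU.
pose box (q : n.-tuple (rat * rat)) : set (n.-tuple R) :=
  [set x | forall i, tnth x i \in `]ratr (tnth q i).1, ratr (tnth q i).2[].
have -> : U = \bigcup_(q in [set: n.-tuple (rat * rat)])
    (if `[<box q `<=` U>] then box q else set0).
  apply/seteqP; split=> [x Ux|x [q _]]; last first.
    by case: ifPn => // /asboolP; exact.
  have [e e0 xU] := oU _ Ux.
  have rat_near i : exists q : rat * rat,
      (ratr q.1 \in `]tnth x i - e, tnth x i[) /\
      (ratr q.2 \in `]tnth x i, tnth x i + e[).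
    have [|a ha] := @rat_in_itvoo R (tnth x i - e) (tnth x i).
      by rewrite gtrBl.
    have [|b hb] := @rat_in_itvoo R (tnth x i) (tnth x i + e).
      by rewrite ltrDl.
    by exists (a, b).
  have /choice [q qP] := rat_near.
  have xq : box [tuple q i | i < n] x.
    move=> i; rewrite tnth_mktuple; have [] := qP i.
    by rewrite !in_itv/= => /andP[_ ->] /andP[-> _].
  exists [tuple q i | i < n] => //; case: ifPn => // /asboolP; case => y yq.
  apply: xU => i; have := yq i; rewrite tnth_mktuple; have [] := qP i.
  rewrite !in_itv/= => /andP[a1 a2] /andP[b1 b2] /andP[y1 y2].
  by rewrite ltr_norml; apply/andP; split; lra.
apply: countable_bigcupT_measurable => // q; case: ifPn => // _.
exact: (@measurable_rectangle _ R n
  (fun i => `]ratr (tnth q i).1, ratr (tnth q i).2[%classic)).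
Qed.

Lemma open_halfspace n (c : 'I_n -> R) (a : R) :
  coordwise_open [set x : n.-tuple R | a < \sum_(i < n) tnth x i * c i].
Proof.
move=> x /=; set sx := \sum_(i < n) _ => a_lt.
have c0 : 0 <= \sum_(i < n) `|c i| by apply: sumr_ge0.
pose e := (sx - a) / (\sum_(i < n) `|c i| + 1).
have e0 : 0 < e by rewrite divr_gt0 ?subr_gt0// ltr_wpDl.
exists e => // y xy.
have : `|\sum_(i < n) tnth y i * c i - sx| <= e * \sum_(i < n) `|c i|.
  rewrite /sx -sumrB mulr_sumr; apply: le_trans (ler_norm_sum _ _ _) _.
  by apply: ler_sum => i _; rewrite -mulrBl normrM ler_wpM2r// ltW.
rewrite ler_norml => /andP[y_ge _] /=; rewrite ltNge; apply/negP => y_le.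
have : e * (\sum_(i < n) `|c i| + 1) = sx - a.
  by rewrite divfK// gt_eqF// ltr_wpDl.
lra.
Qed.

End open.

Section sets.
Context {R : realType} (phi : R -> R).

(** Where it is not -oo, the dual value is an affine function of nu. *)
Lemma I_diamond_gt_open n (alpha : R) :
  coordwise_open [set nu : n.-tuple R | (alpha%:E < I_diamond phi nu)%E].
Proof.
move=> nu /= /ereal_sup_gt[_ [lam lamS <-]].
rewrite -/(dual_value phi nu lam) => lam_gt.
have [lam_fin|/existsNP[j /negP lam_j]] :=
    pselect (forall i, conjugate phi (tnth lam i) \is a fin_num).
  pose c := n%:R^-1 * \sum_(i < n) fine (conjugate phi (tnth lam i)).
  have [|e e0 eP] := @open_halfspace R n (tnth lam) (alpha + c) nu.
    by move: lam_gt; rewrite dual_valueE// lte_fin /= ltrBrDr.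
  exists e => // y /eP/= y_gt; apply: lt_le_trans (dual_value_le phi y lamS).
  by rewrite dual_valueE// lte_fin ltrBrDr.
have n0 : 0 < n%:R^-1 :> R by rewrite invr_gt0 ltr0n (leq_ltn_trans (leq0n j)).
move: (conjugate_gtNy phi (tnth lam j)) lam_j lam_gt.
rewrite fin_numE /dual_value (bigD1 j)//=.
case: (conjugate phi (tnth lam j)) => // _.
by rewrite gt0_muley ?lte_fin//= addNye.
Qed.

Lemma measurable_I_diamond_le n (alpha : R) :
  measurable [set nu : n.-tuple R | (I_diamond phi nu <= alpha%:E)%E].
Proof.
rewrite (_ : [set _ | _] = ~` [set nu | (alpha%:E < I_diamond phi nu)%E]).
  apply: measurableC; apply: coordwise_open_measurable.
  exact: I_diamond_gt_open.
by apply/seteqP; split => nu /=; rewrite leNgt => /negP.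
Qed.

(** On the simplex, changing each loss by at most h changes sum_i mu_i l_i by at
    most h. *)
Lemma worst_case_lt_open n (alpha e b : R) :
  coordwise_open [set x : n.-1.-tuple R |
    (worst_case phi alpha (@losses R n R id b (tnth x)) < e%:E)%E].
Proof.
move=> x /= wc_lt.
have [m wc_m m_e] := lt_EFin_between wc_lt.
pose h := (e - m) / 2; have h0 : 0 < h by rewrite divr_gt0 ?subr_gt0.
exists h => // y xy.
apply: (@le_lt_trans _ _ (m + h)%:E); last by rewrite lte_fin /h; lra.
apply: ge_ereal_sup => _ [mu muA <-]; rewrite lee_fin.
have [[mu1 mu0] _] := muA.
have : (\sum_(i < n) tnth mu i * @losses R n R id b (tnth x) i <= m)%R.
  rewrite -lee_fin; apply: le_trans wc_m; apply: ereal_sup_ubound.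
  by exists mu.
rewrite -(lerD2r h); apply: le_trans.
rewrite -[h]mul1r -mu1 mulr_suml -big_split/=; apply: ler_sum => i _.
rewrite -mulrDr ler_wpM2l// /losses.
case: insub => [j|]; last by rewrite lerDl ltW.
by have := xy j; rewrite ltr_norml => /andP[_]; lra.
Qed.

End sets.

(** * The uniform law on the unit cube and the volume *)

Section cube.
Context {R : realType}.

(* [lebesgue_measure] and [uniform_prob] live on [measurableTypeR R], which has
   another display than the canonical measurable structure of R; [idR] carries
   the uniform law to the latter. *)
Let idR : measurableTypeR R -> R := idfun.

Let measurable_idR : measurable_fun setT idR.
Proof. exact: measurable_id. Qed.

HB.instance Definition _ := isMeasurableFun.Build _ _ _ _ idR measurable_idR.

Definition unif : probability R R :=
  distribution (uniform_prob (@ltr01 R)) idR.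

Lemma integral_unif (f : R -> \bar R) : measurable_fun setT f ->
  (forall x, 0 <= f x)%E ->
  (\int[unif]_x f x = \int[lebesgue_measure]_(x in `[0%R, 1%R]) f x)%E.
Proof.
move=> mf f0; rewrite ge0_integral_distribution//.
by rewrite integral_uniform//= subr0 invr1 mul1e.
Qed.

Lemma unifE (A : set R) : measurable A ->
  unif A = lebesgue_measure (`[0, 1] `&` A : set R).
Proof.
move=> mA; transitivity (\int[unif]_x (\1_A x)%:E)%E.
  by rewrite integral_indic// setIT.
rewrite integral_unif//; last exact/measurable_EFinP.
by rewrite integral_indic// setIC.
Qed.

Lemma volume0 k : volume (set0 : set (k.-tuple R)) = 0%E.
Proof.
elim: k => [|k IH] /=; first by rewrite indic0.
by rewrite integral0_eq// => x _; rewrite -[RHS]IH.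
Qed.

Lemma volume_power k (A : set (k.-tuple R)) : measurable A ->
  A `<=` [set x | forall i, 0 <= tnth x i <= 1] ->
  volume A = power unif k A.
Proof.
elim: k A => [|k IH] A mA A01 //.
rewrite powerS integral_unif//=; last exact: measurable_fun_section.
rewrite [RHS]integral_mkcond; apply: eq_integral => x _.
rewrite patchE; case: ifPn => [_|].
  apply: IH; first exact: measurable_section.
  by move=> t /A01 t01 i; have := t01 (lift ord0 i); rewrite tnthS.
rewrite notin_setE/= in_itv/= => x01; rewrite -[RHS](volume0 k); congr volume.
apply/seteqP; split=> // t /A01 /(_ ord0); rewrite tnth0; exact: x01.
Qed.

Lemma integral_translation (f : R -> \bar R) (c : R) :
  measurable_fun setT f -> (forall x, 0 <= f x)%E ->
  (\int[@lebesgue_measure R]_x f (x - c)%R = \int[@lebesgue_measure R]_x f x)%E.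
Proof.
move=> mf f0.
pose sh : measurableTypeR R -> measurableTypeR R := fun x => x - c.
have msh : measurable_fun setT sh by exact: measurable_funB.
rewrite -[LHS](@ge0_integral_pushforward _ _ _ _ _ sh msh
  lebesgue_measure setT f)//.
apply: eq_measure_integral => A mA _.
apply/esym/lebesgue_measure_unique => // _ [[a b]] _ <-.
transitivity (lebesgue_measure (`]a + c, b + c]%classic : set R)).
  rewrite !lebesgue_measure_itv/= !lte_fin ltrD2r; case: ifP => // _.
  by rewrite -!EFinB; congr EFin; ring.
congr lebesgue_measure; apply/seteqP.
by split => x /=; rewrite !in_itv/= /sh ltrBrDr lerBlDr.
Qed.

Definition spacings k (c : R) (v : k.-tuple R) : k.-tuple R :=
  [tuple of pairmap (fun a b => b - a) c v].

(** The section at x of the preimage is the preimage, for the base point x, of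
    the section of A at x - c; so the induction on the dimension only uses the
    invariance of the Lebesgue measure of the line under translation.  This is
    why the base point c is a parameter. *)
Lemma volume_spacings k (A : set (k.-tuple R)) (c : R) : measurable A ->
  A `<=` [set x | forall i, 0 <= tnth x i <= 1] ->
  volume (spacings c @^-1` A) = volume A.
Proof.
elim: k A c => [|k IH] A c mA A01.
  rewrite /= !indicE; congr (((_ \in _)%:R)%:E); apply/seteqP.
  by split => x /=; rewrite [spacings _ _]tuple0 [x]tuple0.
rewrite /=.
have A_cube x : [set t : k.-tuple R | A [tuple of x :: t]] `<=`
    [set x | forall i, 0 <= tnth x i <= 1].
  by move=> t /A01 t01 i; have := t01 (lift ord0 i); rewrite tnthS.
rewrite -[RHS](integral_translation c).
- apply: eq_integral => x _.
  rewrite -(IH _ x (measurable_section _ mA) (A_cube _)).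
  by congr volume; apply/seteqP; split => t /=; congr A; exact: val_inj.
- apply: eq_measurable_fun (measurable_fun_section unif mA) => x _ /=.
  by rewrite volume_power//; exact: measurable_section.
- by move=> x; rewrite volume_power//; exact: measurable_section.
Qed.

End cube.

(** * Quantiles of a loss bounded above *)

Section quantile.
Context {d} {T : measurableType d} {R : realType} (P : probability T R).
Variables (X : {RV P >-> R}) (b : R).
Hypothesis Xb : P [set w | X w <= b] = 1%E.

Lemma cdf_b : cdf X b = 1%E.
Proof. by rewrite -[RHS]Xb /cdf /distribution /pushforward; congr (P _). Qed.

(** The infimum is that of a nonempty set that is bounded below exactly when
    0 < u <= 1: the case u = 1 uses that X is bounded above.  The value 0
    elsewhere is arbitrary, and keeps the function measurable. *)
Definition quantile (u : R) : R :=
  if 0 < u <= 1 then inf [set x | (u%:E <= cdf X x)%E] else 0.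

(** The Galois connection between quantiles and the distribution function: by
    right continuity of the latter the infimum is attained. *)
Lemma quantile_le (u x : R) : 0 < u <= 1 ->
  (quantile u <= x) = (u%:E <= cdf X x)%E.
Proof.
move=> u01; rewrite /quantile u01; set A := [set x | _].
have A0 : A !=set0 by exists b; rewrite /A/= cdf_b lee_fin; case/andP: u01.
have [m mu] : exists m, (cdf X m < u%:E)%E.
  apply: contrapT => /forallNP F_ge.
  have : (u%:E <= 0)%E.
    apply: (cvge_ge _ (cvg_cdfNy0 X)); apply: nearW => y.
    by rewrite leNgt; apply/negP; exact: F_ge.
  by rewrite lee_fin leNgt; case/andP: u01 => ->.
have A_lb : has_lbound A.
  exists m => z Az; rewrite leNgt; apply/negP => zm.
  have := cdf_nondecreasing X (ltW zm); rewrite leNgt => /negP; apply.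
  exact: lt_le_trans mu Az.
apply/idP/idP => [inf_x|ux]; last exact: ge_inf.
apply: (@le_trans _ _ (cdf X (inf A))); last exact: cdf_nondecreasing.
have Frc := @cdf_right_continuous _ _ _ _ X (inf A).
refine (cvge_ge _ Frc).
near=> y.
have infy : inf A < y by [].
have [z Az zy] := inf_lt A0 infy.
exact: le_trans Az (cdf_nondecreasing X (ltW zy)).
Unshelve. all: by end_near. Qed.

Lemma quantile_nondecreasing (u v : R) : 0 < u -> u <= v -> v <= 1 ->
  quantile u <= quantile v.
Proof.
move=> u0 uv v1; rewrite quantile_le ?u0 ?(le_trans uv)//.
apply: (@le_trans _ _ v%:E); first by rewrite lee_fin.
by rewrite -quantile_le// v1 (lt_le_trans u0).
Qed.

Lemma quantile_le_b (u : R) : 0 < u <= 1 -> quantile u <= b.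
Proof. by move=> u01; rewrite quantile_le// cdf_b lee_fin; case/andP: u01. Qed.

Lemma cdf_fin (x : R) : cdf X x = (fine (cdf X x))%:E.
Proof. by rewrite fineK// fin_num_measure. Qed.

Lemma quantile_preimage (x : R) :
  quantile @^-1` `]-oo, x] =
  `]0, 1] `&` `]-oo, fine (cdf X x)] `|`
  ~` `]0, 1] `&` (if 0 <= x then setT else set0).
Proof.
apply/seteqP; split => u /=; rewrite !in_itv/=.
  have [u01|u01] := boolP (0 < u <= 1).
    by rewrite quantile_le// cdf_fin lee_fin => ?; left.
  by rewrite /quantile (negbTE u01) => -> ; right.
case=> -[u01]; first by rewrite quantile_le// cdf_fin lee_fin.
by rewrite /quantile; move/negP/negbTE: u01 => ->; case: ifP.
Qed.

Lemma measurable_quantile : measurable_fun setT quantile.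
Proof.
apply: (measurability _ (RGenOInfty.measurableE R)) => _ [_ [x ->] <-].
rewrite setTI -setCitvl preimage_setC; apply: measurableC.
rewrite [X in measurable X]quantile_preimage; apply: measurableU.
  exact: measurableI.
by apply: measurableI; [exact: measurableC|case: ifP].
Qed.

HB.instance Definition _ :=
  isMeasurableFun.Build _ _ _ _ quantile measurable_quantile.

Lemma unif_quantile_le (x : R) : unif (quantile @^-1` `]-oo, x]) = cdf X x.
Proof.
have : (0 <= cdf X x <= 1)%E by rewrite cdf_ge0 cdf_le1.
rewrite cdf_fin !lee_fin => /andP[F0 F1].
rewrite unifE; last first.
  by rewrite -[X in measurable X]setTI; exact: measurable_quantile.
rewrite quantile_preimage; case: ifPn => x0.
  rewrite (_ : _ `&` _ = `[0, fine (cdf X x)]%classic); last first.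
    apply/seteqP; split => u /=; rewrite !in_itv/=.
      move=> [/andP[-> u1]] [[_ uF]//|[u01 _]]; rewrite leNgt.
      by apply/negP => Fu; apply: u01; rewrite (le_lt_trans F0 Fu).
    move=> /andP[u0 uF]; rewrite u0 (le_trans uF F1); split => //.
    by case: ltgtP u0 => // u0 _; [left|right].
  rewrite lebesgue_measure_itv/= lte_fin; case: ltgtP F0 => // [F0 _|<- _]//.
  by rewrite oppr0 adde0.
rewrite (_ : _ `&` _ = `]0, fine (cdf X x)]%classic); last first.
  apply/seteqP; split => u /=; rewrite !in_itv/=.
    by move=> [_ [[/andP[-> _]]|[_]]].
  move=> /andP[u0 uF]; rewrite u0 (ltW u0) (le_trans uF F1).
  by split => //; left.
rewrite lebesgue_measure_itv/= lte_fin; case: ltgtP F0 => // [F0 _|<- _]//.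
by rewrite oppr0 adde0.
Qed.

Lemma quantile_law (B : set R) : measurable B ->
  unif (quantile @^-1` B) = P (X @^-1` B).
Proof.
move=> mB.
pose g (k : nat) : set R := `](- k%:R), +oo[%classic.
rewrite -[LHS]/(distribution unif quantile B) -[RHS]/(distribution P X B).
apply: (measure_unique (@RGenOInfty.G R) g) => //.
- exact: RGenOInfty.measurableE.
- move=> _ _ [x ->] [y ->]; exists (Num.max x y).
  apply/seteqP; split => z /=; rewrite !in_itv/= !andbT gt_max.
    by move=> [-> ->].
  by move/andP.
- by move=> k; exists (- k%:R).
- apply/seteqP; split => // x _; exists (Num.bound `|x|) => //=.
  rewrite /g/= in_itv/= andbT ltrNl -normrN.
  by apply: le_lt_trans (ler_norm _) _; apply: archi_boundP.
- move=> _ [x ->].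
  have mE (m : probability R R) :
      m `]x, +oo[%classic = (1 - m `]-oo, x]%classic)%E.
    by rewrite -setCitvl probability_setC.
  apply: etrans (mE (distribution unif quantile)) _.
  apply: etrans (esym (mE (distribution P X))).
  by congr (_ - _)%E; exact: unif_quantile_le.
- move=> k; apply: (@le_lt_trans _ _ 1%E); last exact: ltry.
  apply: (probability_le1 (distribution unif quantile)).
  exact: measurable_itv.
Qed.

(** For us = [:: u_1; ...; u_k] and l = (q u_1, ..., q u_k, b), q being the
    quantile function, this is the sum over i of (l_(i+1) - l_i) w(u_i). *)
Fixpoint layers (w : R -> R) (us : seq R) : R :=
  if us is u :: us' then
    (head b (map quantile us') - quantile u) * w u + layers w us'
  else 0.

(** With u_0 = c and u_(k+1) = 1, this is the sum over i of
    (u_i - u_(i-1)) l_i. *)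
Fixpoint quantile_sum (c : R) (us : seq R) : R :=
  if us is u :: us' then (u - c) * quantile u + quantile_sum u us'
  else (1 - c) * b.

(** Summation by parts. *)
Lemma quantile_sumE c us :
  quantile_sum c us = b - c * head b (map quantile us) - layers id us.
Proof.
elim: us c => [|u us IH] c /=; first by ring.
by rewrite IH; ring.
Qed.

Lemma quantile_le_head (u : R) us : sorted <=%R (u :: us) ->
  all (fun u => 0 < u <= 1) (u :: us) ->
  quantile u <= head b (map quantile us).
Proof.
case: us => [|v us] /=; first by rewrite andbT => _; exact: quantile_le_b.
move=> /andP[uv _] /and3P[/andP[u0 _] /andP[_ v1] _].
exact: quantile_nondecreasing.
Qed.

Lemma layers_le w1 w2 (us : seq R) :
  sorted <=%R us -> all (fun u => 0 < u <= 1) us ->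
  {in us, forall u, w1 u <= w2 u} -> layers w1 us <= layers w2 us.
Proof.
elim: us => // u us IH us_sorted us01 w12 /=.
have us_sorted' := path_sorted us_sorted.
have us01' : all (fun u => 0 < u <= 1) us by case/andP: us01.
rewrite lerD// ?IH// => [|v vus]; last by apply: w12; rewrite in_cons vus orbT.
by rewrite ler_wpM2l ?subr_ge0 ?quantile_le_head// w12// mem_head.
Qed.

(** The left-hand side is b minus the smallest entry of l that is at least x; the
    bound x <= b - layers is what is used.  The maximum with the first entry of l
    makes the induction go through. *)
Lemma layers_indic_le (us : seq R) (x : R) : sorted <=%R us -> x <= b ->
  all (fun u => 0 < u <= 1) us ->
  layers (fun u => (x <= quantile u)%R%:R) us <=
    b - Num.max x (head b (map quantile us)).
Proof.
move=> + xb; elim: us => [|u us IH] us_sorted us01 /=.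
  by rewrite max_r// subrr.
have := quantile_le_head us_sorted us01.
have us01' : all (fun u => 0 < u <= 1) us by case/andP: us01.
have := IH (path_sorted us_sorted) us01'.
set h := head _ _ => le_layers uh; have [xu|ux] := leP x (quantile u).
  by move: le_layers; rewrite max_r ?(le_trans xu)// mulr1; lra.
rewrite mulr0 add0r; apply: (le_trans le_layers).
by rewrite lerD2l lerN2 le_max lexx.
Qed.

Let Y us w := layers (fun u => (X w <= quantile u)%R%:R) us.

Let indic_le (a : R) w : \1_(X @^-1` `]-oo, a]) w = (X w <= a)%R%:R :> R.
Proof.
rewrite indicE; congr (_%:R); congr nat_of_bool; apply/idP/idP.
  by rewrite inE/= in_itv.
by move=> ?; rewrite inE/= in_itv.
Qed.

Lemma measurable_layers us : measurable_fun setT (Y us).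
Proof.
elim: us => [|u us IH]; first exact: measurable_cst.
apply: measurable_funD => //; apply: measurable_funM => //.
rewrite (_ : (fun _ => _) = \1_(X @^-1` `]-oo, quantile u])); last first.
  by apply/funext => w; rewrite indic_le.
apply: measurable_indic; rewrite -[X in measurable X]setTI.
exact: measurable_funP.
Qed.

Lemma integral_layers us :
  P.-integrable setT (EFin \o Y us) /\
  (\int[P]_w (Y us w)%:E =
   (layers (fun u => fine (cdf X (quantile u))) us)%:E)%E.
Proof.
elim: us => [|u us [IHi IHe]].
  by rewrite /Y/= integral0; split => //; exact: integrable0.
set h := head b (map quantile us) - quantile u.
have YE w : (Y (u :: us) w)%:E =
    (h%:E * (\1_(X @^-1` `]-oo, quantile u]) w)%:E + (Y us w)%:E)%E.
  by rewrite /Y/= EFinD EFinM indic_le.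
have mX : measurable (X @^-1` `]-oo, quantile u]).
  by rewrite -[X in measurable X]setTI; exact: measurable_funP.
have i1 : P.-integrable setT
    (fun w => (h%:E * (\1_(X @^-1` `]-oo, quantile u]) w)%:E)%E).
  by apply: integrableZl => //; exact: integrable_indic.
split.
  apply: (eq_integrable _ _ _ _ (integrableD _ i1 IHi)) => // w _.
  by rewrite /= YE.
under eq_integral do rewrite YE.
rewrite integralD// IHe integralZl//; last exact: integrable_indic.
by rewrite integral_indic// setIT [RHS]EFinD EFinM -cdf_fin.
Qed.

(** The functions need not be integrable: the loss, which is only bounded above,
    may have expectation -oo. *)
Lemma ae_le_integral (f g : T -> \bar R) :
  measurable_fun setT f -> measurable_fun setT g ->
  {ae P, forall w, (f w <= g w)%E} -> (\int[P]_w f w <= \int[P]_w g w)%E.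
Proof.
move=> mf mg fg; rewrite integralE [leRHS]integralE; apply: leeB.
  apply: ae_ge0_le_integral => //; try exact: measurable_funepos.
  by apply: filterS fg => w fgw _; rewrite !funeposE le_max2.
apply: ae_ge0_le_integral => //; try exact: measurable_funeneg.
by apply: filterS fg => w fgw _; rewrite !funenegE le_max2// leeN2.
Qed.

(** Almost surely X <= b - Y; the expectation of Y involves the weights
    P(X <= q u_i), which are at least u_i. *)
Lemma expectation_le (us : seq R) :
  sorted <=%R us -> all (fun u => 0 < u <= 1) us ->
  ('E_P[X] <= (quantile_sum 0 us)%:E)%E.
Proof.
move=> us_sorted us01; rewrite unlock.
have [iY eY] := integral_layers us.
have mXb : measurable [set w | X w <= b].
  rewrite (_ : [set _ | _] = setT `&` X @^-1` `]-oo, b]).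
    exact: measurable_funP.
  by apply/seteqP; split => w /=; rewrite in_itv//= => -[].
apply: (@le_trans _ _ (\int[P]_w (b%:E - (Y us w)%:E))%E).
  apply: ae_le_integral.
  - exact/measurable_EFinP.
  - apply: emeasurable_funB => //; apply/measurable_EFinP.
    exact: measurable_layers.
  - exists (~` [set w | X w <= b]); split.
    + exact: measurableC.
    + by rewrite probability_setC// Xb subee.
    + apply: subsetC => w /= Xwb; rewrite -EFinB lee_fin lerBrDr -lerBrDl.
      apply: le_trans (layers_indic_le us_sorted Xwb us01) _.
      by rewrite lerD2l lerN2 le_max lexx.
rewrite integralB//; last exact: finite_measure_integrable_cst.
rewrite eY integral_cst//.
rewrite [X in (_ * X - _)%E](_ : _ = 1%E); last exact: (probability_setT P).
rewrite mule1 -EFinB lee_fin.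
rewrite quantile_sumE mul0r subr0 lerD2l lerN2; apply: layers_le => // u uus.
have u01 := allP us01 _ uus.
by rewrite -lee_fin -cdf_fin -quantile_le.
Qed.

End quantile.

(** * Spacings and the uniform law on the simplex *)

Section rcons_tuple.
Context {T : Type}.

Lemma tnth_rcons_lift k (x : k.-tuple T) (a : T) (j : 'I_k) :
  tnth [tuple of rcons x a] (lift ord_max j) = tnth x j.
Proof.
by rewrite (tnth_nth a) lift_max (tnth_nth a) /= nth_rcons size_tuple ltn_ord.
Qed.

Lemma tnth_rcons_max k (x : k.-tuple T) (a : T) :
  tnth [tuple of rcons x a] ord_max = a.
Proof. by rewrite (tnth_nth a) /= nth_rcons size_tuple ltnn eqxx. Qed.

End rcons_tuple.

Lemma losses_rcons (R : realType) k (x : k.-tuple R) (b : R) :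
  @losses R k.+1 R id b (tnth x) = tnth [tuple of rcons x b].
Proof.
apply/funext => i; rewrite /losses; case: (unliftP ord_max i) => [j|] ->.
  rewrite tnth_rcons_lift; case: insubP => [j' _ j'E|]; last first.
    by rewrite -[val _]/(nat_of_ord (lift ord_max j)) lift_max ltn_ord.
  by congr tnth; apply: val_inj; rewrite j'E; exact: lift_max.
by rewrite tnth_rcons_max; case: insubP => //; rewrite /= ltnn.
Qed.

Section complete.
Context {R : realType}.

(** The inverse of [drop_last] on the simplex. *)
Definition complete k (x : k.-tuple R) : k.+1.-tuple R :=
  [tuple of rcons x (1 - \sum_(i < k) tnth x i)].

Lemma drop_last_simplex k (B : set (k.+1.-tuple R)) :
  @drop_last R k.+1 @` (@simplex R k.+1 `&` B) =
  @complete k @^-1` (@simplex R k.+1 `&` B).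
Proof.
have drop_lastK (nu : k.+1.-tuple R) :
    simplex nu -> complete (drop_last nu) = nu.
  move=> [nu1 _]; apply: eq_from_tnth => i.
  case: (unliftP ord_max i) => [j|] ->.
    rewrite tnth_rcons_lift tnth_mktuple; congr tnth; apply: val_inj.
    exact/esym/lift_max.
  rewrite tnth_rcons_max -nu1 big_ord_recr/=.
  rewrite [X in _ + _ - X](eq_bigr
    (fun i => tnth nu (widen_ord (leqnSn k) i))).
    by rewrite addrAC subrr add0r.
  by move=> j _; rewrite tnth_mktuple; congr tnth; exact: val_inj.
apply/seteqP; split => [_ [nu [nuS nuB] <-]|x [xS xB]] /=.
  by rewrite drop_lastK.
exists (complete x); first by split.
apply: eq_from_tnth => i; rewrite tnth_mktuple.
rewrite -[RHS](tnth_rcons_lift _ (1 - \sum_(i < k) tnth x i)).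
by congr tnth; apply: val_inj; exact/esym/lift_max.
Qed.

Lemma measurable_complete k : measurable_fun setT (@complete k).
Proof.
apply/measurable_fun_tnthP => i; case: (unliftP ord_max i) => [j|] ->.
  rewrite (_ : _ \o _ = (@tnth k R)^~ j); first exact: measurable_tnth.
  by apply/funext => x /=; rewrite tnth_rcons_lift.
rewrite (_ : _ \o _ = fun x => 1 - \sum_(i < k) tnth x i).
  apply: measurable_funB => //; apply: measurable_sum => j.
  exact: measurable_tnth.
by apply/funext => x /=; rewrite tnth_rcons_max.
Qed.

Lemma measurable_simplex n : measurable (@simplex R n).
Proof.
rewrite (_ : @simplex R n = (fun x => \sum_(i < n) tnth x i) @^-1` [set 1] `&`
    rectangle (fun=> `[0, +oo[%classic : set R)).
  apply: measurableI; last exact: measurable_rectangle.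
  rewrite -[X in measurable X]setTI; apply: measurable_sum => // i.
  exact: measurable_tnth.
apply/seteqP; split => x [x1 x0]; split => // i.
  by rewrite /= in_itv/= x0.
by have := x0 i; rewrite /= in_itv/= andbT.
Qed.

Lemma measurable_spacings k c : measurable_fun setT (@spacings R k c).
Proof.
apply/measurable_fun_tnthP => -[[|i] ik].
  rewrite (_ : _ \o _ = fun x => tnth x (Ordinal ik) - c).
    by apply: measurable_funB => //; exact: measurable_tnth.
  apply/funext => x /=; rewrite !(tnth_nth 0)/=.
  by case: (tval x) (size_tuple x) ik => [<-|].
rewrite (_ : _ \o _ =
    fun x => tnth x (Ordinal ik) - tnth x (Ordinal (ltnW ik))).
  by apply: measurable_funB; exact: measurable_tnth.
apply/funext => x /=; rewrite !(tnth_nth 0)/=.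
by rewrite (nth_pairmap 0) ?size_tuple.
Qed.

Lemma sum_spacings k c (x : k.-tuple R) :
  \sum_(i < k) tnth (spacings c x) i = last c x - c.
Proof.
rewrite -(big_tuple _ _ _ predT (fun i => i))/=.
elim: (tval x) c => [|a s IH] c /=; first by rewrite big_nil subrr.
by rewrite big_cons IH; ring.
Qed.

Lemma path_spacings (c : R) (s : seq R) :
  path <%R c s = all (fun a => 0 < a) (pairmap (fun a b => b - a) c s).
Proof. by elim: s c => //= a s IH c; rewrite subr_gt0 IH. Qed.

Lemma path_le_last (c a : R) (s : seq R) :
  path <%R c s -> a \in s -> a <= last c s.
Proof.
elim: s c a => // x s IH c a /= /andP[_ xs]; rewrite in_cons.
move=> /predU1P[->|/IH]; last exact.
case: s xs {IH} => // y s /order_path_min-/(_ lt_trans) xs.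
by apply/ltW/(allP xs); exact: (mem_last y s).
Qed.

(** A strictly sorted rearrangement of x determines both the rearranged tuple and,
    as it has no repetition, the permutation. *)
Lemma permute_sorted_inj k (x : k.-tuple R) (s1 s2 : 'S_k) :
  sorted <%R (permute s1 x) -> sorted <%R (permute s2 x) -> s1 = s2.
Proof.
move=> x1 x2.
have x_inj : injective (tnth x).
  move=> i j xij; apply: (@perm_inj _ s1^-1%g).
  have /tuple_uniqP : uniq (permute s1 x) by exact: lt_sorted_uniq.
  by apply; rewrite !tnth_mktuple !permKV.
have memE (s : 'S_k) : permute s x =i x.
  move=> a; apply/tnthP/tnthP => -[i ->].
    by exists (s i); rewrite tnth_mktuple.
  by exists (s^-1%g i); rewrite tnth_mktuple permKV.
have x12 : permute s1 x = permute s2 x.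
  apply: val_inj; apply: lt_sorted_eq => // a.
  by rewrite memE -(memE s2).
apply/perm.permP => i; apply: x_inj.
by have := congr1 (fun t => tnth t i) x12; rewrite !tnth_mktuple.
Qed.

(** The left-hand side is the probability of B under the uniform distribution on
    the simplex.  Up to a null set the first k coordinates of the points of B are
    positive, hence are the spacings of a strictly sorted u; the volume of these
    u is the same, and their k! rearrangements are distinct points of S. *)
Lemma uniform_le k (B : set (k.+1.-tuple R)) (S : set (k.-tuple R)) :
  measurable B -> measurable S ->
  (forall x s, S (permute s x) -> S x) ->
  (forall u : k.-tuple R, path <%R 0 u -> all (fun a => 0 < a <= 1) u ->
     simplex (complete (spacings 0 u)) -> B (complete (spacings 0 u)) -> S u) ->
  (k`!%:R%:E * volume (@drop_last R k.+1 @` (@simplex R k.+1 `&` B)) <=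
   power unif k S)%E.
Proof.
move=> mB mS S_sym BS; rewrite drop_last_simplex; set A := _ @^-1` _.
have mA : measurable A.
  rewrite -[X in measurable X]setTI; apply: measurable_complete => //.
  by apply: measurableI => //; exact: measurable_simplex.
have A01 : A `<=` [set x | forall i, 0 <= tnth x i <= 1].
  move=> x [[x1 x0] _] i.
  have xi0 j : 0 <= tnth x j.
    by have := x0 (lift ord_max j); rewrite tnth_rcons_lift.
  rewrite xi0/=; have := x0 ord_max; rewrite tnth_rcons_max (bigD1 i)//=.
  have : 0 <= \sum_(j < k | j != i) tnth x j by apply: sumr_ge0.
  lra.
pose pos : set (k.-tuple R) := rectangle (fun=> `]0, +oo[%classic : set R).
have mpos : measurable pos by exact: measurable_rectangle.
have pos1 : power unif k pos = 1%E.
  rewrite power_rectangle// big1// => i _.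
  rewrite unifE// (_ : _ `&` _ = `]0, 1]%classic).
    by rewrite lebesgue_measure_itv/= lte_fin ltr01 oppr0 adde0.
  apply/seteqP; split => x /=; rewrite !in_itv/= andbT.
    by move=> [/andP[_ ->] ->].
  by move=> /andP[x0 ->]; rewrite x0 (ltW x0).
pose A0 := A `&` pos.
have mA0 : measurable A0 by exact: measurableI.
have A001 : A0 `<=` [set x | forall i, 0 <= tnth x i <= 1].
  by move=> x [/A01].
pose V := spacings 0 @^-1` A0.
have mV : measurable V.
  by rewrite -[X in measurable X]setTI; exact: measurable_spacings.
have V_path u : V u -> path <%R 0 u.
  move=> [_ u_pos]; rewrite path_spacings.
  apply/allP => a /(@tnthP _ _ (spacings 0 u))[i ->].
  by have := u_pos i; rewrite /= in_itv/= andbT.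
have V01 u : V u -> all (fun a => 0 < a <= 1) u.
  move=> Vu; have u_path := V_path _ Vu.
  have last1 : last 0 u <= 1.
    case: Vu => -[[[_ /(_ ord_max)] + _] _].
    by rewrite tnth_rcons_max sum_spacings subr0 subr_ge0.
  have := order_path_min lt_trans u_path => u_gt0.
  apply/allP => a au; rewrite (allP u_gt0)//=; apply: le_trans last1.
  exact: path_le_last.
have AV : volume A = power unif k V.
  rewrite -volume_power//; last first.
    move=> u /V01 u01 i.
    by have /andP[/ltW -> ->] := allP u01 _ (mem_tnth i u).
  rewrite /V volume_spacings// !volume_power//.
  rewrite -[in LHS](setIT A) -(setUv pos) setIUr measureU0//.
  - by apply: measurableI => //; exact: measurableC.
  - have : power unif k (~` pos) = 0%E by rewrite probability_setC// pos1 subee.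
    apply: subset_measure0 => //; last exact: measurableC.
    by apply: measurableI => //; exact: measurableC.
rewrite AV; apply: power_symmetrize => //.
- move=> x s Vx; apply: (S_sym _ s); apply: BS.
  + exact: V_path.
  + exact: V01.
  + by case: Vx => -[[]].
  + by case: Vx => -[[]].
- move=> x s1 s2 /V_path/path_sorted p1 /V_path/path_sorted p2.
  exact: permute_sorted_inj p1 p2.
Qed.

End complete.

(** * Coverage of the mean *)

Section law.
Context {d} {T : measurableType d} {R : realType}.
Context (P : probability T R) (k : nat).
Variables (X : {RV P >-> R}) (Xs : 'I_k -> {RV P >-> R}) (b : R).
Hypothesis Xb : P [set w | X w <= b] = 1%E.
Hypothesis Xs_id : forall i, identically_distributed (Xs i) X.
Hypothesis Xs_indep : mutually_independent Xs.

Lemma pairing_quantile_sum (us : seq R) m (c : R) : size us = m ->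
  \sum_(i < m.+1)
    nth 0 (rcons (pairmap (fun x y => y - x) c us) (1 - last c us)) i *
    nth 0 (rcons (map (quantile X) us) b) i = quantile_sum X b c us.
Proof.
elim: us m c => [|u us IH] m c <- /=; first by rewrite big_ord1.
by rewrite big_ord_recl/= -(IH (size us)).
Qed.

Definition quantiles (u : k.-tuple R) : k.-tuple R :=
  map_tuple (quantile X) u.

Lemma pairing_complete (u : k.-tuple R) :
  pairing (complete (spacings 0 u)) [tuple of rcons (quantiles u) b] =
  quantile_sum X b 0 u.
Proof.
rewrite -(pairing_quantile_sum _ (size_tuple u)); apply: eq_bigr => i _.
by rewrite !(tnth_nth 0)/= sum_spacings subr0.
Qed.

Lemma measurable_quantiles : measurable_fun setT quantiles.
Proof.
apply/measurable_fun_tnthP => i.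
rewrite (_ : _ \o _ = quantile X \o (@tnth k R)^~ i).
  apply: measurableT_comp; first exact: (measurable_quantile Xb).
  exact: measurable_tnth.
by apply/funext => u /=; rewrite tnth_map.
Qed.

HB.instance Definition _ :=
  isMeasurableFun.Build _ _ _ _ quantiles measurable_quantiles.

Definition sample (w : T) : k.-tuple R := [tuple Xs i w | i < k].

Lemma measurable_sample : measurable_fun setT sample.
Proof.
apply/measurable_fun_tnthP => i.
rewrite (_ : _ \o _ = Xs i); first exact: measurable_funP.
by apply/funext => u /=; rewrite tnth_mktuple.
Qed.

HB.instance Definition _ :=
  isMeasurableFun.Build _ _ _ _ sample measurable_sample.

(** Both sides are probabilities in A that agree on rectangles: by independence
    on the left, by construction on the right. *)
Lemma sample_law (A : set (k.-tuple R)) : measurable A ->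
  P (sample @^-1` A) = power unif k (quantiles @^-1` A).
Proof.
move=> mA.
rewrite -[LHS]/(distribution P sample A).
rewrite -[RHS]/(distribution (power unif k) quantiles A).
apply: tuple_probability_unique => // B mB.
transitivity (\prod_(i < k) unif (quantile X @^-1` B i))%E.
  transitivity (P (\bigcap_(i in [set` [set: 'I_k]%SET]) (Xs i @^-1` B i))).
    congr (P _); apply/seteqP; split => w wB i.
      by have := wB i; rewrite tnth_mktuple.
    by have := wB i; rewrite tnth_mktuple; apply; rewrite /= inE.
  rewrite Xs_indep//; apply: eq_big => [i|i _]; first by rewrite inE.
  by rewrite (quantile_law Xb (mB i)); exact: Xs_id.
rewrite -power_rectangle => [|i]; last first.
  by rewrite -[X in measurable X]setTI; exact: (measurable_quantile Xb).
congr (power unif k _); apply/seteqP; split => u uB i; have := uB i.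
  by rewrite tnth_map.
by rewrite tnth_map.
Qed.

End law.

Section coverage.
Context {d} {T : measurableType d} {R : realType}.
Context (P : probability T R) (k : nat).
Variables (X : {RV P >-> R}) (Xs : 'I_k -> {RV P >-> R}) (b : R).
Hypothesis Xb : P [set w | X w <= b] = 1%E.
Hypothesis Xs_id : forall i, identically_distributed (Xs i) X.
Hypothesis Xs_indep : mutually_independent Xs.
Variable phi : R -> R.
Hypothesis phi_convex : convex_Rplus phi.
Hypothesis phi1 : phi 1 = 0.

(* the event of the theorem, as a set of values of the k sampled losses *)
Let covers alpha := [set x : k.-tuple R |
  ('E_P[X] <= worst_case phi alpha (@losses R k.+1 R id b (tnth x)))%E].

Lemma expectation_le_b : ('E_P[X] <= b%:E)%E.
Proof.
(* no sorted point at all: the step function is the constant b *)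
have := @expectation_le _ _ _ P X b Xb [::] isT isT.
by rewrite /= subr0 mul1r.
Qed.

Lemma measurable_covers alpha : measurable (covers alpha).
Proof.
rewrite /covers; case: ('E_P[X])%E expectation_le_b => [e _| |_].
- rewrite (_ : [set _ | _] = ~` [set x : k.-tuple R |
      (worst_case phi alpha (@losses R k.+1 R id b (tnth x)) < e%:E)%E]).
    apply: measurableC; apply: coordwise_open_measurable.
    exact: (@worst_case_lt_open R phi k.+1).
  by apply/seteqP; split => x /=; rewrite leNgt => /negP.
- by rewrite leye_eq.
- rewrite (_ : [set _ | _] = setT)//; apply/seteqP.
  by split => // x _ /=; rewrite leNye.
Qed.

(** A permutation of the k samples extends to one of the k + 1 losses that fixes
    the bound b. *)
Lemma covers_permute alpha x s : covers alpha (permute s x) -> covers alpha x.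
Proof.
rewrite /covers /= !losses_rcons.
rewrite (_ : tnth _ =
    tnth [tuple of rcons x b] \o lift_perm ord_max ord_max s).
  by rewrite worst_case_perm.
apply/funext => i /=; case: (unliftP ord_max i) => [j|] ->.
  by rewrite lift_perm_lift !tnth_rcons_lift tnth_mktuple.
by rewrite lift_perm_id !tnth_rcons_max.
Qed.

Lemma sorted_quantiles (us : seq R) : sorted <=%R us ->
  all (fun a => 0 < a <= 1) us -> sorted <=%R (rcons (map (quantile X) us) b).
Proof.
elim: us => // u us IH us_sorted us01 /=.
have := IH (path_sorted us_sorted) (proj2 (andP us01)).
have := quantile_le_head Xb us_sorted us01.
by case: us {IH us_sorted us01} => [|v us] /= -> //.
Qed.

Lemma quantiles_cover alpha (u : k.-tuple R) : 0 < alpha ->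
  path <%R 0 u -> all (fun a => 0 < a <= 1) u ->
  simplex (complete (spacings 0 u)) ->
  (I_diamond phi (complete (spacings 0 u)) <= alpha%:E)%E ->
  covers alpha (quantiles X u).
Proof.
move=> alpha0 u_path u01 nuS nu_alpha; rewrite /covers/= losses_rcons.
have u_sorted : sorted <=%R u.
  by apply: sub_sorted (path_sorted u_path) => x y /ltW.
apply: le_trans (expectation_le Xb u_sorted u01) _.
rewrite -pairing_complete; apply: worst_case_ge => //.
exact: sorted_quantiles.
Qed.

(** Two radii appear because the duality needs a positive one. *)
Lemma coverage d' (T' : measurableType d') (P' : probability T' R)
    (nu : {RV P' >-> k.+1.-tuple R}) (alpha alpha' : R) :
  uniform_on_simplex nu -> 0 < alpha' -> alpha <= alpha' ->
  (P' [set w | I_diamond phi (nu w) <= alpha%:E] <=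
   P [set w | 'E_P[X] <=
              worst_case phi alpha' (@losses R k.+1 R id b (Xs^~ w))])%E.
Proof.
move=> nu_unif alpha'0 aa'.
have mB := @measurable_I_diamond_le R phi k.+1 alpha.
rewrite -[leLHS]/(distribution P' nu [set x | (I_diamond phi x <= alpha%:E)%E]).
rewrite (nu_unif _ mB).
rewrite (_ : [set w | _] = sample Xs @^-1` covers alpha'); last first.
  by apply/seteqP; split => w /=; congr (_ <= worst_case _ _ _)%E;
    apply/funext => i; rewrite /losses; case: insub => // j;
    rewrite tnth_mktuple.
rewrite (sample_law Xb)//; last exact: measurable_covers.
apply: uniform_le => //.
- rewrite -[X in measurable X]setTI.
  exact: (@measurable_quantiles _ _ _ _ k _ _ Xb measurableT _
    (measurable_covers _)).
- move=> u s /=.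
  rewrite -[quantiles X (permute s u)](_ : permute s (quantiles X u) = _).
    exact: covers_permute.
  by apply: eq_from_tnth => i; rewrite !(tnth_mktuple, tnth_map).
- move=> u u_path u01 nuS /= nu_alpha; apply: quantiles_cover => //.
  by apply: le_trans nu_alpha _; rewrite lee_fin.
Qed.

End coverage.

Theorem mainTheorem2 (R : realType) (n n_theta n_xi : nat)
  (hn : (2 <= n)%N)
  (Theta : set (n_theta.-tuple R)) (Xi : set (n_xi.-tuple R))
  (ell : n_theta.-tuple R -> n_xi.-tuple R -> R)
  (d : measure_display) (Omega : measurableType d) (P : probability Omega R)
  (xi : {RV P >-> n_xi.-tuple R})
  (xs : 'I_n.-1 -> {RV P >-> n_xi.-tuple R})
  (ell_n : n_theta.-tuple R -> R)
  (ell_meas : forall theta, Theta theta -> trace_measurable Xi (ell theta))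
  (xi_Xi : forall w, Xi (xi w))
  (xs_Xi : forall i w, Xi (xs i w))
  (xs_indep : mutually_independent xs)
  (xs_id : forall i, identically_distributed (xs i) xi)
  (ell_nP : forall theta, Theta theta ->
     P [set w | ell theta (xi w) <= ell_n theta] = 1%E)
  (phi : R -> R)
  (phi_lsc : lsc_Rplus phi) (phi_convex : convex_Rplus phi)
  (phi1 : phi 1 = 0)
  (delta : R) (delta01 : 0 <= delta <= 1)
  (d' : measure_display) (Omega' : measurableType d')
  (P' : probability Omega' R)
  (nu : {RV P' >-> n.-tuple R})
  (nu_unif : uniform_on_simplex nu) :
  (ereal_inf [set alpha%:E | alpha in [set alpha : R |
      forall theta, Theta theta ->
        (1 - delta)%:E <=
          P [set w | 'E_P[fun w' => ell theta (xi w')] <=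
                     worst_case phi alpha
                       (losses (ell theta) (ell_n theta) (xs^~ w))]]]
   <=
   ereal_inf [set alpha%:E | alpha in [set alpha : R |
      (1 - delta)%:E <= P' [set w | I_diamond phi (nu w) <= alpha%:E]]])%E.
Proof.
case: n hn xs xs_Xi xs_indep xs_id nu nu_unif => // k _.
move=> xs xs_Xi xs_indep xs_id nu nu_unif.
apply: le_ereal_inf_tmp => _ [alpha /= alphaP <-].
apply/lee_addgt0Pr => e e0; apply: ereal_inf_lbound.
exists (alpha + e) => // theta theta_in.
have [delta1|delta1] := leP (1 - delta) 0.
  by apply: le_trans (measure_ge0 _ _); rewrite lee_fin.
have alpha0 : 0 <= alpha.
  (* an event of positive probability meets the simplex *)
  have mB := @measurable_I_diamond_le R phi k.+1 alpha.
  have : (0 < distribution P' nu [set x | (I_diamond phi x <= alpha%:E)%E])%E.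
    by apply: lt_le_trans alphaP; rewrite lte_fin.
  rewrite (nu_unif _ mB).
  have [->|/set0P[x [xS xB]] _] := eqVneq (@simplex R k.+1 `&`
      [set x | (I_diamond phi x <= alpha%:E)%E]) set0.
    by rewrite image_set0 volume0 mule0 ltxx.
  by rewrite -lee_fin; apply: le_trans xB; apply: I_diamond_ge0.
(* as Xi may fail to be measurable, preimages of Borel sets under the losses are
   rewritten as preimages of measurable sets C with the right trace on Xi *)
have pull B : measurable B -> exists C, measurable C /\
    forall Y : Omega -> n_xi.-tuple R, (forall w, Xi (Y w)) ->
      (ell theta \o Y) @^-1` B = Y @^-1` C.
  move=> mB; have [C mC BC] := ell_meas _ theta_in _ mB.
  exists C; split => // Y YXi; apply/seteqP; split => w /= h.
    by have [] : (Xi `&` C) (Y w) by rewrite -BC.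
  by have [] : (Xi `&` ell theta @^-1` B) (Y w) by rewrite BC.
have mY (Y : {RV P >-> n_xi.-tuple R}) : (forall w, Xi (Y w)) ->
    measurable_fun setT (ell theta \o Y).
  move=> YXi _ B mB; have [C [mC ->//]] := pull _ mB.
  exact: measurable_funP.
pose X : {RV P >-> R} := HB.pack (ell theta \o xi)
  (isMeasurableFun.Build _ _ _ _ _ (mY xi xi_Xi)).
pose Xs i : {RV P >-> R} := HB.pack (ell theta \o xs i)
  (isMeasurableFun.Build _ _ _ _ _ (mY (xs i) (xs_Xi i))).
apply: le_trans alphaP _.
have Xs_id i : identically_distributed (Xs i) X.
  move=> A mA; have [C [mC CE]] := pull _ mA.
  rewrite /distribution /pushforward /= (CE _ (xs_Xi i)) (CE _ xi_Xi).
  exact: xs_id.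
have Xs_indep : mutually_independent Xs.
  move=> J A mA.
  have /choice[C CP] : forall i, exists C, measurable C /\
      forall Y : Omega -> n_xi.-tuple R, (forall w, Xi (Y w)) ->
      (ell theta \o Y) @^-1` A i = Y @^-1` C by move=> i; exact: pull.
  transitivity (P (\bigcap_(i in [set` J]) (xs i @^-1` C i))).
    by congr (P _); apply: eq_bigcapr => i _; exact: (CP i).2 _ (xs_Xi i).
  rewrite xs_indep => [|i]; last exact: (CP i).1.
  apply: eq_bigr => i _; congr (P _); apply/esym.
  exact: (CP i).2 _ (xs_Xi i).
have := @coverage _ _ _ P k X Xs (ell_n theta) (ell_nP _ theta_in)
  Xs_id Xs_indep phi phi_convex phi1 _ _ P' nu alpha (alpha + e) nu_unif.
move=> /(_ _ _)/le_trans; apply; first by rewrite ltr_wpDl.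
  by rewrite lerDl ltW.
by [].
Qed.
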